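(* Let $K$ be a $\Delta$-$\sigma$-field, let $P$ be a prime $\Delta$-$\sigma$-ideal of the ring of $\Delta$-$\sigma$-polynomials $R=K\{y_1,\dots,y_n\}$, and let $P^*$ be the reflexive closure of $P$ in $R$. Then there exists $k\in\mathbb{N}$ such that $P^*=\sigma^{-k}(P)$, where $\sigma^{-k}(P)=\{f\in R\mid \sigma^k(f)\in P\}$.
   Context: $\mathbb{N}$ denotes the non-negative integers. All fields have characteristic zero. A $\Delta$-$\sigma$-ring (difference-differential ring with one translation) is a commutative ring with unity together with a finite set $\Delta=\{\delta_1,\dots,\delta_m\}$ of derivations (the case $\Delta=\emptyset$ is allowed) and an injective ring endomorphism $\sigma$, such that any two of the maps in $\Delta\cup\{\sigma\}$ commute; a $\Delta$-$\sigma$-field is such a ring that is a field. $T$ is the free commutative semigroup of all power products $\delta_1^{k_1}\cdots\delta_m^{k_m}\sigma^l$ ($k_i,l\in\mathbb{N}$). The ring of $\Delta$-$\sigma$-polynomials $K\{y_1,\dots,y_n\}$ is the polynomial ring over $K$ in the indeterminates $\tau y_j$ ($\tau\in T$, $1\le j\le n$), made into a $\Delta$-$\sigma$-ring by $\alpha(\tau y_j)=(\alpha\tau)y_j$ for $\alpha\in\Delta\cup\{\sigma\}$ and by letting $\Delta\cup\{\sigma\}$ act on coefficients as on $K$. A $\Delta$-$\sigma$-ideal is an ideal closed under all maps of $\Delta\cup\{\sigma\}$; it is called prime if it is a prime ideal. The reflexive closure of a $\Delta$-$\sigma$-ideal $I$ of $R$ is $I^*=\{a\in R\mid \sigma^k(a)\in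 I\text{ for some }k\in\mathbb{N}\}$. *)

(* Defs.v *)
From HB Require Import structures.
From mathcomp Require Import all_boot all_algebra.
From mathcomp Require Import finmap zify.
From mathcomp Require Import boolp classical_sets.
From mathcomp.multinomials Require Import monalg.

Set Implicit Arguments.
Unset Strict Implicit.
Unset Printing Implicit Defensive.

Import GRing.Theory.
Local Open Scope ring_scope.

(* Difference-differential rings with m commuting derivations and one
   translation sigma. The derivations are indexed by 'I_m, so m = 0 is the case
   of no derivation; sigma is injective but need not be surjective. *)
HB.mixin Record isDiffDiff (m : nat) R of GRing.ComPzRing R := {
  delta : 'I_m -> R -> R;
  sigma : R -> R;
  deltaD : forall i, {morph delta i : x y / x + y};
  deltaM : forall i x y, delta i (x * y) = delta i x * y + x * delta i y;
  sigmaD : {morph sigma : x y / x + y};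
  sigmaM : {morph sigma : x y / x * y};
  sigma1 : sigma 1 = 1;
  sigma_inj : injective sigma;
  delta_comm : forall i j x, delta i (delta j x) = delta j (delta i x);
  delta_sigma : forall i x, delta i (sigma x) = sigma (delta i x)
}.

#[short(type="ddRingType")]
HB.structure Definition DiffDiffRing (m : nat) :=
  { R of isDiffDiff m R & GRing.ComPzRing R }.

#[short(type="ddFieldType")]
HB.structure Definition DiffDiffField (m : nat) :=
  { K of isDiffDiff m K & GRing.Field K }.

Section AdditiveMaps.
Context (m : nat) (R : ddRingType m).

Fact delta_is_additive (i : 'I_m) : additive (@delta m R i).
Proof.
move=> x y; have d0 : delta i (0 : R) = 0.
  by apply: (addIr (delta i (0 : R))); rewrite -deltaD add0r add0r.
have dN z : delta i (- z : R) = - delta i z.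
  by apply/eqP; rewrite -addr_eq0 -deltaD addNr d0.
by rewrite deltaD dN.
Qed.
HB.instance Definition _ (i : 'I_m) :=
  GRing.isAdditive.Build R R (@delta m R i) (delta_is_additive i).

Fact sigma_is_additive : additive (@sigma m R).
Proof.
move=> x y; have s0 : sigma (0 : R) = 0.
  by apply: (addIr (sigma (0 : R))); rewrite -sigmaD add0r add0r.
have sN z : sigma (- z : R) = - sigma z.
  by apply/eqP; rewrite -addr_eq0 -sigmaD addNr s0.
by rewrite sigmaD sN.
Qed.
HB.instance Definition _ :=
  GRing.isAdditive.Build R R (@sigma m R) sigma_is_additive.
HB.instance Definition _ :=
  GRing.isMultiplicative.Build R R (@sigma m R) (@sigmaM m R, @sigma1 m R).

(* The maps of Delta u {sigma} indexed by [option 'I_m]: [None] stands for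
   sigma and [Some i] for delta_i. *)
Definition ddop (a : option 'I_m) : R -> R :=
  if a is Some i then delta i else sigma.

End AdditiveMaps.

(* The semigroup T is the free commutative monoid on Delta u {sigma}, and a
   variable [(t, j)] is the indeterminate t y_j. The polynomial ring over K in
   these infinitely many indeterminates is the monoid algebra of their
   monomials. *)
Notation ddmonoid m := {cmonom (option 'I_m)}.
Notation ddvar m n := (ddmonoid m * 'I_n)%type.
Notation ddpoly m K n := {malg K[{cmonom (ddvar m n)}]}.

Lemma mulrn_split (A : pzRingType) (x a b c d : A) p q :
  ((0 < p)%N -> x = a * b) -> ((0 < q)%N -> x = c * d) ->
  x *+ (p + q) = (a *+ p) * b + c * (d *+ q).
Proof.
move=> hp hq; rewrite mulrnDr mulrnAl mulrnAr; congr (_ + _).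
  by case: p hp => [|p] hp; [rewrite !mulr0n | rewrite hp].
by case: q hq => [|q] hq; [rewrite !mulr0n | rewrite hq].
Qed.

Lemma divcm_shiftl (I : choiceType) (k l u : cmonom I) v : (0 < k v)%N ->
  mmul (divcm (mmul k l) (ucm v)) u = mmul (mmul (divcm k (ucm v)) u) l.
Proof.
move=> kv; apply/eqP/cmP => w.
rewrite (cmM w (divcm (mmul k l) (ucm v)) u) divcmE (cmM w k l).
rewrite (cmM w (mmul (divcm k (ucm v)) u) l) (cmM w (divcm k (ucm v)) u) divcmE.
by rewrite cmU; case: eqP kv => [<-|_]; lia.
Qed.

Lemma divcm_shiftr (I : choiceType) (k l u : cmonom I) v : (0 < l v)%N ->
  mmul (divcm (mmul k l) (ucm v)) u = mmul k (mmul (divcm l (ucm v)) u).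
Proof.
by move=> lv; rewrite [mmul k l]mulmC divcm_shiftl // mulmC.
Qed.

Lemma divcmUK (I : choiceType) (k : cmonom I) v : (0 < k v)%N ->
  k = mmul (divcm k (ucm v)) (ucm v).
Proof.
move=> kv; apply/eqP/cmP => w; rewrite (cmM w (divcm k _)) divcmE cmU.
by case: eqP kv => [<-|_]; lia.
Qed.

Lemma divcmUU (I : choiceType) (u : cmonom I) v :
  mmul (divcm (ucm v) (ucm v)) u = u.
Proof.
by apply/eqP/cmP => w; rewrite (cmM w (divcm _ _) u) divcmE subnn.
Qed.

Section Leibniz.
Context (A : comPzRingType) (D E S : A -> A).
Hypotheses (DD : {morph D : x y / x + y}) (ED : {morph E : x y / x + y}).
Hypotheses (SD : {morph S : x y / x + y}) (SM : {morph S : x y / x * y}).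

Lemma leibnizDl x y z : D (x * z) = D x * z + x * D z ->
  D (y * z) = D y * z + y * D z ->
  D ((x + y) * z) = D (x + y) * z + (x + y) * D z.
Proof. by move=> hx hy; rewrite mulrDl !DD hx hy !mulrDl addrACA. Qed.

Lemma leibnizDr x y z : D (z * x) = D z * x + z * D x ->
  D (z * y) = D z * y + z * D y ->
  D (z * (x + y)) = D z * (x + y) + z * D (x + y).
Proof. by move=> hx hy; rewrite mulrDr !DD hx hy !mulrDr addrACA. Qed.

Hypothesis DM : forall x y, D (x * y) = D x * y + x * D y.
Hypothesis EM : forall x y, E (x * y) = E x * y + x * E y.

Lemma leibniz_comm x y : D (E x) = E (D x) -> D (E y) = E (D y) ->
  D (E (x * y)) = E (D (x * y)).
Proof.
move=> hx hy; rewrite EM DM DD ED !DM !EM hx hy -!addrA.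
by congr (_ + _); rewrite addrCA.
Qed.

Lemma leibniz_endo x y : D (S x) = S (D x) -> D (S y) = S (D y) ->
  D (S (x * y)) = S (D (x * y)).
Proof. by move=> hx hy; rewrite SM !DM SD !SM hx hy. Qed.

Lemma comm_add (F G : A -> A) : {morph F : x y / x + y} ->
  {morph G : x y / x + y} -> forall x y, F (G x) = G (F x) ->
  F (G y) = G (F y) -> F (G (x + y)) = G (F (x + y)).
Proof. by move=> FD GD x y hx hy; rewrite GD !FD GD hx hy. Qed.

End Leibniz.

Lemma leibniz_scale (K : comNzRingType) (A : comAlgType K) (D : A -> A)
    (a b a' b' : K) (x y x' y' : A) :
  D (a *: x) = a' *: x + a *: x' -> D (b *: y) = b' *: y + b *: y' ->
  D ((a * b) *: (x * y)) =
    (a' * b + a * b') *: (x * y) + (a * b) *: (x' * y + x * y') ->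
  D (a *: x * (b *: y)) = D (a *: x) * (b *: y) + a *: x * D (b *: y).
Proof.
move=> hx hy hxy; rewrite hx hy -scalerAl -scalerAr scalerA hxy.
rewrite mulrDl mulrDr -!scalerAl -!scalerAr !scalerA scalerDl scalerDr.
by rewrite addrACA.
Qed.

Lemma comm_gen (X Y : Type) (h : X -> Y) (F G : Y -> Y) (f g : X -> X) :
  (forall x, G (h x) = h (g x)) -> (forall x, F (h x) = h (f x)) ->
  (forall x, f (g x) = g (f x)) -> forall x, F (G (h x)) = G (F (h x)).
Proof. by move=> hg hf fg x; rewrite hg !hf hg fg. Qed.

Section DDPoly.
Context (m : nat) (K : ddFieldType m) (n : nat).

Local Notation V := (ddvar m n).
Local Notation M := {cmonom V}.
Local Notation R := (ddpoly m K n).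

(* Action of Delta u {sigma} on the indeterminates: a (t y_j) = (a t) y_j. *)
Definition ddact (a : option 'I_m) (v : V) : V := (mmul (ucm a) v.1, v.2).

Definition dvar (t : ddmonoid m) (j : 'I_n) : R := << ucm (t, j) >>.

Definition psigma_mon (k : M) : M :=
  \big[mmul/mone]_(v <- finsupp k) expcmn (ucm (ddact None v)) (k v).

Definition psigma_monU (k : M) : R := << psigma_mon k >>.

Definition psigma (f : R) : R := mmap (fun c => (sigma c)%:MP) psigma_monU f.

(* The image under delta_i of a monomial k, by the Leibniz rule:
   the sum over v of (dk/dv) * delta_i v. *)
Definition pdelta_mon (i : 'I_m) (k : M) : R :=
  \sum_(v <- finsupp k)
    << mmul (divcm k (ucm v)) (ucm (ddact (Some i) v)) >> *+ k v.

Definition pdelta (i : 'I_m) (f : R) : R :=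
  mmap (fun c => (delta i c)%:MP) (fun k => << k >>) f +
  mmap (fun c => c%:MP) (pdelta_mon i) f.

Lemma expcmnE (I : choiceType) (a : cmonom I) p i :
  expcmn a p i = (p * a i)%N.
Proof.
rewrite /expcmn; case: p => [|p]; first by rewrite onecmE.
by elim: p => [|p IH]; rewrite ?mul1n // mulcmE IH.
Qed.

Lemma psigma_monEw (d : {fset V}) (k : M) v : (finsupp k `<=` d)%fset ->
  psigma_mon k v = (\sum_(w <- d) k w * (ddact None w == v))%N.
Proof.
move=> le.
have -> : psigma_mon k v =
    (\sum_(w <- finsupp k) k w * (ddact None w == v))%N.
  rewrite /psigma_mon; elim/big_rec2: _ => [|w x y _ <-]; first by rewrite cm1.
  by rewrite cmM expcmnE cmU.
rewrite (big_fset_incl _ le) // => w _.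
by rewrite -cmE_eq0 => /eqP->; rewrite mul0n.
Qed.

Lemma ddact_inj a : injective (ddact a).
Proof.
move=> [t j] [t' j'] [] /eqP/cmP h ->; congr pair; apply/eqP/cmP => x.
by move: (h x); rewrite !cmM => /addnI.
Qed.

Lemma ddactC a b v : ddact a (ddact b v) = ddact b (ddact a v).
Proof. by congr pair; rewrite /= !mulmA [mmul (ucm a) _]mulmC. Qed.

Lemma psigma_monE k v : psigma_mon k (ddact None v) = k v.
Proof.
rewrite (psigma_monEw _ (fsubset_refl _)).
under eq_bigr => w _ do rewrite (inj_eq (@ddact_inj _)).
have [vk|vk] := boolP (v \in finsupp k).
  rewrite (big_fsetD1 v) //= eqxx muln1 big1_fset ?addn0 // => w.
  by rewrite !inE => /andP[/negPf-> _]; rewrite muln0.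
have -> : k v = 0%N by apply/eqP; rewrite cmE_eq0.
rewrite big1_fset // => w wk _; case: eqP => [e|]; last by rewrite muln0.
by rewrite -e wk in vk.
Qed.

Lemma psigma_monM k l : psigma_mon (mmul k l) = mmul (psigma_mon k) (psigma_mon l).
Proof.
apply/eqP/cmP => v; pose d := (finsupp k `|` finsupp l)%fset.
rewrite cmM !(@psigma_monEw d) ?mdomD ?fsubset_refl ?fsubsetUl ?fsubsetUr //.
rewrite -big_split /=; apply: eq_bigr => w _.
by rewrite cmM mulnDl.
Qed.

Lemma psigma_mon1 : psigma_mon mone = mone.
Proof. by rewrite /psigma_mon mdom1 big_seq_fset0. Qed.

Lemma psigma_mon_inj : injective psigma_mon.
Proof.
by move=> k l e; apply/eqP/cmP => v; rewrite -[LHS]psigma_monE e psigma_monE.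
Qed.

Fact psigma_monU_multiplicative : mmorphism psigma_monU.
Proof.
split=> [k l|]; rewrite /psigma_monU; last by rewrite psigma_mon1.
by rewrite psigma_monM malgM_def fgmulUU mulr1.
Qed.
HB.instance Definition _ :=
  isMultiplicative.Build M R psigma_monU psigma_monU_multiplicative.

Lemma psigmaD : {morph psigma : f g / f + g}.
Proof. exact: (raddfD (mmap (malgC \o @sigma m K) _)). Qed.

Lemma psigmaM : {morph psigma : f g / f * g}.
Proof.
move=> f g; exact: (rmorphM (mmap (malgC \o @sigma m K) psigma_monU) f g).
Qed.

Lemma psigmaU c k : psigma << c *g k >> = << sigma c *g psigma_mon k >>.
Proof.
by rewrite /psigma (mmapU (f := malgC \o @sigma m K)) /=
  malgM_def fgmulUU mulr1 mul1m.
Qed.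

Lemma psigma1 : psigma 1 = 1.
Proof. by rewrite psigmaU psigma_mon1 sigma1. Qed.

Lemma mcoeff_psigma f k : (psigma f)@_(psigma_mon k) = sigma f@_k.
Proof.
rewrite {1}[f]monalgE (big_morph psigma psigmaD (raddf0 (mmap (malgC \o @sigma m K) _))).
rewrite raddf_sum /=.
under eq_bigr => l _ do
  rewrite psigmaU mcoeffU (inj_eq psigma_mon_inj).
have [kf|kf] := boolP (k \in msupp f); last first.
  rewrite (mcoeff_outdom kf) raddf0 big1_fset // => l lf _.
  by case: eqP => [e|]; [rewrite -e lf in kf | rewrite mulr0n].
rewrite (big_fsetD1 k) //= eqxx mulr1n big1_fset ?addr0 // => l.
by rewrite !inE => /andP[/negPf-> _]; rewrite mulr0n.
Qed.

Lemma psigma_inj : injective psigma.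
Proof.
move=> f g e; apply/malgP => k; apply: (@sigma_inj m K).
by rewrite -!mcoeff_psigma e.
Qed.

Lemma pdeltaD i : {morph pdelta i : f g / f + g}.
Proof.
move=> f g; rewrite /pdelta addrACA; apply: f_equal2.
  exact: (raddfD (mmap (malgC \o @delta m K i) (fun k => << k >> : R)) f g).
exact: (raddfD (mmap malgC (pdelta_mon i)) f g).
Qed.

Lemma pdelta0 i : pdelta i 0 = 0.
Proof. by apply: (addIr (pdelta i 0)); rewrite -pdeltaD add0r add0r. Qed.

Lemma pdeltaU i c k :
  pdelta i << c *g k >> = << delta i c *g k >> + c *: pdelta_mon i k.
Proof.
rewrite /pdelta; apply: f_equal2.
  apply: etrans (mmapU (f := malgC \o @delta m K i)
    (h := fun k => << k >> : R) c k) _.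
  by rewrite malgM_def fgmulUU mulr1 mul1m.
apply: etrans (mmapU (f := malgC) (h := pdelta_mon i) c k) _.
exact: mul_malgC.
Qed.

Lemma pdelta_monEw i (d : {fset V}) (k : M) : (finsupp k `<=` d)%fset ->
  pdelta_mon i k = \sum_(v <- d)
    << mmul (divcm k (ucm v)) (ucm (ddact (Some i) v)) >> *+ k v.
Proof.
move=> le; rewrite /pdelta_mon (big_fset_incl _ le) // => w _.
by rewrite -cmE_eq0 => /eqP->; rewrite mulr0n.
Qed.

Lemma pdelta_monM i k l : pdelta_mon i (mmul k l) =
  pdelta_mon i k * << l >> + << k >> * pdelta_mon i l.
Proof.
pose d := (finsupp k `|` finsupp l)%fset.
rewrite !(@pdelta_monEw _ d) ?mdomD ?fsubset_refl ?fsubsetUl ?fsubsetUr //.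
rewrite mulr_suml mulr_sumr -big_split /=; apply: eq_bigr => v _.
rewrite (cmM v k l); apply: mulrn_split => h; rewrite malgM_def fgmulUU mulr1.
  exact: (f_equal (fun q : M => << q >> : R) (divcm_shiftl l _ h)).
exact: (f_equal (fun q : M => << q >> : R) (divcm_shiftr k _ h)).
Qed.

Lemma ddpoly_indU (Q : R -> Prop) : (forall c k, Q << c *g k >>) ->
  (forall f g, Q f -> Q g -> Q (f + g)) -> forall f, Q f.
Proof.
move=> QU QD f; rewrite [f]monalgE; elim/big_ind: _ => //.
by have := QU 0 mone; rewrite monalgU0.
Qed.

Lemma ddpoly_ind (Q : R -> Prop) : (forall c, Q c%:MP) ->
  (forall v, Q << ucm v >>) -> (forall f g, Q f -> Q g -> Q (f + g)) ->
  (forall f g, Q f -> Q g -> Q (f * g)) -> forall f, Q f.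
Proof.
move=> QC QV QD QM; apply: ddpoly_indU => // c k.
have -> : << c *g k >> = c%:MP * << k >> :> R.
  by rewrite malgM_def fgmulUU mulr1 mul1m.
apply: (QM) => //.
have [p] := ubnP (mdeg k); elim: p k => // p IH k; rewrite ltnS => lekp.
have [/eqP/mdeg_eq0I->|nk] := boolP (mdeg k == 0%N); first exact: QC.
have [v kv] : exists v, (0 < k v)%N.
  case: (fset_0Vmem (finsupp k)) => [e|[v vk]].
    by rewrite mdegE e big_seq_fset0 eqxx in nk.
  by exists v; rewrite lt0n cmE_neq0.
have ek := divcmUK kv.
have -> : << k >> = << divcm k (ucm v) >> * << ucm v >> :> R.
  by rewrite malgM_def fgmulUU mulr1 -ek.
apply: (QM) => //; apply: IH.
by move: lekp; rewrite {1}ek mdegM mdegU addn1.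
Qed.

Lemma malgUZ c q : << c *g q >> = c *: << q >> :> R.
Proof. by rewrite -mul_malgC malgM_def fgmulUU mulr1 mul1m. Qed.

Lemma pdeltaZ i c k : pdelta i (c *: << k >>) =
  delta i c *: << k >> + c *: pdelta_mon i k.
Proof. by rewrite -!malgUZ pdeltaU. Qed.

Lemma pdeltaM i f g : pdelta i (f * g) = pdelta i f * g + f * pdelta i g.
Proof.
elim/ddpoly_indU: f => [a k|f1 f2 h1 h2]; last first.
  exact: (leibnizDl (pdeltaD i) h1 h2).
elim/ddpoly_indU: g => [b l|g1 g2 h1 h2]; last first.
  exact: (leibnizDr (pdeltaD i) h1 h2).
rewrite (malgUZ a k) (malgUZ b l).
apply: leibniz_scale (pdeltaZ i a k) (pdeltaZ i b l) _.
have UU : << k >> * << l >> = << mmul k l >> :> R.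
  by rewrite malgM_def fgmulUU mulr1.
rewrite UU; apply: etrans (pdeltaZ i (a * b) (mmul k l)) _.
by rewrite pdelta_monM deltaM.
Qed.

Lemma psigmaC c : psigma c%:MP = (sigma c)%:MP.
Proof. by rewrite psigmaU psigma_mon1. Qed.

Lemma psigmaV v : psigma << ucm v >> = << ucm (ddact None v) >>.
Proof.
rewrite psigmaU sigma1; apply: (f_equal (fun q : M => << q >> : R)).
by rewrite /psigma_mon mdomU big_seq_fset1 cmUU.
Qed.

Lemma pdeltaC i c : pdelta i c%:MP = (delta i c)%:MP.
Proof. by rewrite pdeltaU /pdelta_mon mdom1 big_seq_fset0 scaler0 addr0. Qed.

Lemma delta1 i : delta i (1 : K) = 0.
Proof.
apply: (addIr (delta i (1 : K))).
by rewrite add0r -{3}[1]mulr1 deltaM mulr1 mul1r.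
Qed.

Lemma pdeltaV i v : pdelta i << ucm v >> = << ucm (ddact (Some i) v) >>.
Proof.
have d1 : << delta i (1 : K) *g ucm v >> = 0 :> R.
  by apply: etrans (f_equal _ (delta1 i)) _; exact: monalgU0.
apply: etrans (pdeltaU i 1 (ucm v)) _.
apply: etrans (f_equal2 +%R d1 (scale1r _)) _; rewrite add0r.
rewrite /pdelta_mon mdomU big_seq_fset1 (cmUU v) mulr1n.
exact: (f_equal (fun q : M => << q >> : R) (divcmUU _ v)).
Qed.

Lemma pdelta_comm i j f : pdelta i (pdelta j f) = pdelta j (pdelta i f).
Proof.
elim/ddpoly_ind: f => [c|v|f g hf hg|f g hf hg].
- exact: (comm_gen (pdeltaC j) (pdeltaC i) (delta_comm i j)).
- exact: (comm_gen (pdeltaV j) (pdeltaV i) (ddactC (Some i) (Some j))).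
- exact: (comm_add (pdeltaD i) (pdeltaD j) hf hg).
- exact: (leibniz_comm (pdeltaD i) (pdeltaD j) (pdeltaM i) (pdeltaM j) hf hg).
Qed.

Lemma pdelta_psigma i f : pdelta i (psigma f) = psigma (pdelta i f).
Proof.
elim/ddpoly_ind: f => [c|v|f g hf hg|f g hf hg].
- exact: (comm_gen psigmaC (pdeltaC i) (delta_sigma i)).
- exact: (comm_gen psigmaV (pdeltaV i) (ddactC (Some i) None)).
- exact: (comm_add (pdeltaD i) psigmaD hf hg).
- exact: (leibniz_endo psigmaD psigmaM (pdeltaM i) hf hg).
Qed.

End DDPoly.

HB.instance Definition _ (m : nat) (K : ddFieldType m) (n : nat) :=
  isDiffDiff.Build m (ddpoly m K n)
    (@pdeltaD m K n) (@pdeltaM m K n) (@psigmaD m K n) (@psigmaM m K n)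
    (@psigma1 m K n) (@psigma_inj m K n) (@pdelta_comm m K n)
    (@pdelta_psigma m K n).

(* The Delta-sigma-ring structure of K{y_1, ..., y_n} extends the one of K and
   acts on the indeterminates through T. *)
Section DDPolyAction.
Context (m : nat) (K : ddFieldType m) (n : nat).
Local Notation R := (ddpoly m K n).

Lemma ddop_const a (c : K) : ddop a (c%:MP : R) = (ddop a c)%:MP.
Proof. by case: a => [i|]; [exact: pdeltaC | exact: psigmaC]. Qed.

Lemma ddop_dvar a t j :
  ddop a (dvar K t j : R) = dvar K (mmul (ucm a) t) j.
Proof. by case: a => [i|]; [exact: pdeltaV | exact: psigmaV]. Qed.

End DDPolyAction.

(* Ideals are arbitrary, not necessarily decidable, subsets, which is why the
   boolean ideals of ring_quotient are not used. *)
Section Ideals.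
Local Open Scope classical_set_scope.
Context (m : nat) (R : ddRingType m).
Implicit Type I : set R.

Definition is_ideal I : Prop :=
  [/\ I 0, forall x y, I x -> I y -> I (x + y) & forall a x, I x -> I (a * x)].

Definition is_prime_ideal I : Prop :=
  [/\ is_ideal I, ~ I 1 & forall x y, I (x * y) -> I x \/ I y].

Definition is_dd_ideal I : Prop :=
  is_ideal I /\ forall (a : option 'I_m) x, I x -> I (ddop a x).

Definition is_prime_dd_ideal I : Prop := is_dd_ideal I /\ is_prime_ideal I.

Definition reflexive_closure I : set R :=
  [set a | exists k : nat, I (iter k sigma a)].

End Ideals.

(* Main.v *)
(* P* is the union of the increasing chain of prime ideals P_k = sigma^-k(P),
   and a in P* as soon as sigma(a) in P*. Rank the indeterminates by a total
   well-order compatible with T. If P* is contained in no P_k, let f_k be an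
   element of P* \ P_k of least leader and then least degree in its leader.
   By minimality, and characteristic zero for the second one, neither the
   leading coefficient nor the separant of f_k is in P*.
   Dickson's lemma gives i such that for arbitrarily large k the leader of f_k
   is theta (leader of f_i), theta in T, and deg f_k >= deg f_i. Take k so large
   that f_i is in P_k. The leading coefficient of theta f_i is an image under a
   power of sigma of the leading coefficient or the separant of f_i, so it is not in
   P*, so reducing f_k once by theta f_i in P_k puts f_k in P_k, a contradiction. *)
Require Import Defs.
From mathcomp Require Import all_boot all_algebra.
From mathcomp Require Import finmap zify ring.
From mathcomp Require Import boolp classical_sets.
From mathcomp.multinomials Require Import monalg.

Set Implicit Arguments.
Unset Strict Implicit.
Unset Printing Implicit Defensive.

Import GRing.Theory.
Local Open Scope ring_scope.
Local Open Scope classical_set_scope.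

(** * Lexicographic orders given by natural-number measures *)

Lemma ex_min_measure (T : Type) (f : T -> nat) (A : set T) :
  A !=set0 -> exists2 x, A x & forall y, A y -> (f x <= f y)%N.
Proof.
case=> x Ax; have [p] := ubnP (f x); elim: p x Ax => // p IH x Ax lt_p.
have [[y Ay lt_y]|nex] := pselect (exists2 y, A y & (f y < f x)%N).
  by apply: (IH y Ay); lia.
by exists x => // y Ay; rewrite leqNgt; apply/negP => lt_y; apply: nex; exists y.
Qed.

Section Lexicographic.
Context (I : eqType) (T : Type) (c : I -> T -> nat).
Implicit Types (s : seq I) (x y z : T).

Fixpoint lexlt s x y : bool :=
  if s is i :: s' then
    (c i x < c i y)%N || (c i x == c i y) && lexlt s' x y
  else false.

Lemma lexlt_trans s x y z : lexlt s x y -> lexlt s y z -> lexlt s x z.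
Proof.
elim: s => //= i s IH /orP[xy|/andP[/eqP-> xy]] /orP[yz|/andP[/eqP<- yz]].
- by rewrite (ltn_trans xy yz).
- by rewrite xy.
- by rewrite yz.
- by rewrite eqxx IH ?orbT.
Qed.

Lemma lexlt_total s x y :
  [\/ lexlt s x y, lexlt s y x | {in s, forall i, c i x = c i y}].
Proof.
elim: s => [|i s IH]; first by constructor 3.
rewrite /=; case: (ltngtP (c i x) (c i y)) => [||e]; [by constructor..|].
case: IH => [||h]; [by constructor..|constructor 3 => j].
by rewrite inE => /orP[/eqP->|/h].
Qed.

(** Minimise the first measure, then apply induction to the set of elements attaining that
    minimum. *)
Lemma lexlt_min s (A : set T) :
  A !=set0 -> exists2 x, A x & forall y, lexlt s y x -> ~ A y.
Proof.
elim: s A => [|i s IH] A A0 /=; first by case: A0 => x; exists x.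
have [x Ax xmin] := ex_min_measure (c i) A0.
have [|y [Ay eyx] ymin] := IH [set y | A y /\ c i y = c i x]; first by exists x.
exists y => // z; rewrite eyx => /orP[ltzx /xmin|/andP[/eqP ezx ltzy] Az].
  by rewrite leqNgt ltzx.
exact: (ymin z).
Qed.

Lemma lexlt_translate s (h : T -> T) (e : I -> nat) :
  (forall i x, c i (h x) = e i + c i x)%N ->
  forall x y, lexlt s (h x) (h y) = lexlt s x y.
Proof.
move=> hc x y; elim: s => //= i s ->.
by rewrite !hc ltn_add2l eqn_add2l.
Qed.

(** The first measure that [h] changes goes up, and it decides the comparison. *)
Lemma lexlt_incr s (h : T -> T) :
  (forall i x, c i x <= c i (h x))%N ->
  forall x, (exists2 i, i \in s & c i x < c i (h x))%N -> lexlt s x (h x).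
Proof.
move=> ch x; elim: s => [[] //|i s IH [j]] /=.
have := ch i x; rewrite leq_eqVlt => /orP[/eqP e|->//].
rewrite -e ltnn eqxx /= inE => /orP[/eqP->|js ltj]; first by rewrite -e ltnn.
by apply: IH; exists j.
Qed.

End Lexicographic.

(** * Nondecreasing subsequences and Dickson's lemma *)

Lemma nondecreasing_subseq (u : nat -> nat) : exists g : nat -> nat,
  {homo g : i j / (i < j)%N} /\ {homo (fun i => u (g i)) : i j / (i <= j)%N}.
Proof.
have next a : exists2 b, (a <= b)%N & forall k, (a <= k)%N -> (u b <= u k)%N.
  by apply: (@ex_min_measure _ u [set k | (a <= k)%N]); exists a; rewrite /=.
have [b ab bmin] : exists2 b : nat -> nat, (forall a, a <= b a)%N &
    forall a k, (a <= k)%N -> (u (b a) <= u k)%N.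
  exists (fun a => sval (cid2 (next a))) => a; by case: (cid2 (next a)).
pose g := fix g i := if i is i'.+1 then b (g i').+1 else b 0%N.
have gS i : (g i < g i.+1)%N by rewrite /= ab.
have gmono : {homo g : i j / (i < j)%N} by apply: homo_ltn => //; apply: ltn_trans.
exists g; split=> //; apply: homo_leq => [x|y x z|i]; [exact: leqnn|exact: leq_trans|].
(* Every [g i] minimises [u] over some tail of indices, and that tail contains [g i.+1]. *)
suff [a ea le_a] : exists2 a, g i = b a & (a <= g i.+1)%N by rewrite ea bmin.
case: i => [|i]; first by exists 0%N.
by exists (g i).+1 => //; rewrite (leq_trans (gmono i i.+1 _)) // ltnW.
Qed.

(* Dickson's lemma, for a sequence of points with coordinates [u a]. *)
Lemma nondecreasing_subseq_family (I : eqType) (s : seq I)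
    (u : I -> nat -> nat) : exists g : nat -> nat,
  {homo g : i j / (i < j)%N} /\
  {in s, forall a, {homo (fun i => u a (g i)) : i j / (i <= j)%N}}.
Proof.
elim: s => [|a s [g [gmono us]]]; first by exists id; split.
have [h [hmono ua]] := nondecreasing_subseq (fun i => u a (g i)).
exists (fun i => g (h i)); split=> [i j ij|b].
  exact: (gmono _ _ (hmono _ _ ij)).
rewrite inE => /orP[/eqP->|bs]; first exact: ua.
by move=> i j ij; apply: (us b bs); exact: (ltnW_homo hmono).
Qed.

(** The chain rule: [map_poly D] differentiates the coefficients, and the separant appears as the
    coefficient of [D x]. *)
Lemma derivation_horner (A : comNzRingType) (D : {additive A -> A}) :
  (forall x y, D (x * y) = D x * y + x * D y) ->
  forall (p : {poly A}) x, D p.[x] = (map_poly D p).[x] + p^`().[x] * D x.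
Proof.
move=> DM p x; elim/poly_ind: p => [|q c IH].
  by rewrite deriv0 map_poly0 !horner0 raddf0 mul0r addr0.
have -> : map_poly D (q * 'X + c%:P) = map_poly D q * 'X + (D c)%:P.
  apply/polyP => i; rewrite coef_map_id0 ?raddf0 // !coefD !coefMX !coefC.
  rewrite coef_map_id0 ?raddf0 // raddfD.
  by case: (i == 0%N); rewrite ?raddf0.
rewrite derivD derivM derivX derivC !hornerE raddfD DM IH; ring.
Qed.

(** * Polynomials in a given set of indeterminates *)

Section Generated.
Context (m : nat) (K : ddFieldType m) (n : nat).
Local Notation V := (ddvar m n).
Local Notation R := (ddpoly m K n).
Implicit Types (A B : set V) (v w : V) (f g : R) (p q : {poly R}).

Definition dvarX v : R := << ucm v >>.

(** The subalgebra K[A], as an inductive predicate so that its properties follow by induction,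
    without inspecting supports of monomials. *)
Inductive gen A : R -> Prop :=
| gen_const c : gen A c%:MP
| gen_var w of A w : gen A (dvarX w)
| gen_add f g of gen A f & gen A g : gen A (f + g)
| gen_mul f g of gen A f & gen A g : gen A (f * g).

Lemma gen_setT f : gen setT f.
Proof.
elim/ddpoly_ind: f => [c|v|f g|f g].
- exact: gen_const.
- exact: gen_var.
- exact: gen_add.
- exact: gen_mul.
Qed.

Lemma gen_sub A B f : A `<=` B -> gen A f -> gen B f.
Proof.
move=> AB; elim=> [c|v /AB|f1 f2 _ h1 _|f1 f2 _ h1 _].
- exact: gen_const.
- exact: gen_var.
- exact: gen_add.
- exact: gen_mul.
Qed.

Lemma gen_opp A f : gen A f -> gen A (- f).
Proof.
move=> hf; have -> : - f = (- 1)%:MP * f by rewrite raddfN mulN1r.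
by apply: gen_mul => //; exact: gen_const.
Qed.

Lemma gen_nat A i : gen A i%:R.
Proof.
have -> : i%:R = (i%:R)%:MP :> R by rewrite rmorph_nat.
exact: gen_const.
Qed.

Lemma ddopD a f g : ddop a (f + g) = ddop a f + ddop a g.
Proof. by case: a => [i|]; [exact: pdeltaD|exact: psigmaD]. Qed.

Lemma ddopM_sigma f g : ddop None (f * g) = ddop None f * ddop None g.
Proof. exact: psigmaM. Qed.

Lemma ddopM_delta i f g :
  ddop (Some i) (f * g) = ddop (Some i) f * g + f * ddop (Some i) g.
Proof. exact: pdeltaM. Qed.

(** [B] contains [A] as well as its image under [a] because the Leibniz rule leaves one factor
    undifferentiated. *)
Lemma gen_ddop A B a f : A `<=` B -> A `<=` ddact a @^-1` B -> gen A f ->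
  gen B (ddop a f).
Proof.
move=> AB AaB; elim=> [c|v Av|f1 f2 _ h1 _ h2|f1 f2 g1 h1 g2 h2].
- by rewrite ddop_const; exact: gen_const.
- case: v Av => t j /AaB Bv; rewrite [ddop _ _]ddop_dvar; exact: gen_var.
- by rewrite ddopD; exact: gen_add.
- case: a {AaB} h1 h2 => [i|] h1 h2; last by rewrite ddopM_sigma; exact: gen_mul.
  by rewrite ddopM_delta; apply: gen_add; apply: gen_mul => //; exact: gen_sub AB _.
Qed.

Definition gen_poly A p := forall i, gen A p`_i.

Lemma gen_polyD A p q : gen_poly A p -> gen_poly A q -> gen_poly A (p + q).
Proof. by move=> hp hq i; rewrite coefD; exact: gen_add. Qed.

Lemma gen_polyN A p : gen_poly A p -> gen_poly A (- p).
Proof. by move=> hp i; rewrite coefN; exact: gen_opp. Qed.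

Lemma gen_polyM A p q : gen_poly A p -> gen_poly A q -> gen_poly A (p * q).
Proof.
move=> hp hq i; rewrite coefM; elim/big_rec: _ => [|j x _]; first exact: (gen_nat A 0).
by apply: gen_add; exact: gen_mul.
Qed.

Lemma gen_polyC A f : gen A f -> gen_poly A f%:P.
Proof. by move=> hf i; rewrite coefC; case: eqP => // _; exact: (gen_nat A 0). Qed.

Lemma gen_polyXn A i : gen_poly A 'X^i.
Proof. by move=> j; rewrite coefXn; exact: gen_nat. Qed.

Lemma gen_polyX A : gen_poly A 'X.
Proof. exact: (gen_polyXn A 1). Qed.

Lemma gen_poly_deriv A p : gen_poly A p -> gen_poly A p^`().
Proof.
by move=> hp i; rewrite coef_deriv -mulr_natr; apply: gen_mul => //; exact: gen_nat.
Qed.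

Lemma gen_horner A p f : gen_poly A p -> gen A f -> gen A p.[f].
Proof.
move=> hp hf; rewrite horner_coef; elim/big_rec: _ => [|i x _ hx].
  exact: (gen_nat A 0).
apply: gen_add => //; apply: gen_mul => //.
elim: (nat_of_ord i) => [|j IH]; first exact: (gen_nat A 1).
by rewrite exprS; exact: gen_mul.
Qed.

(** Turns an element of K[A, v] into a univariate polynomial in [v], whose size, leading coefficient
    and derivative can then be used. *)
Lemma gen_setU1 A v f : gen (v |` A) f ->
  exists2 p, gen_poly A p & f = p.[dvarX v].
Proof.
elim=> [c|w [->|Aw]|f1 f2 _ [p1 h1 ->] _ [p2 h2 ->]|f1 f2 _ [p1 h1 ->] _ [p2 h2 ->]].
- by exists (c%:MP)%:P; rewrite ?hornerC //; apply: gen_polyC; exact: gen_const.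
- by exists 'X; rewrite ?hornerX //; exact: gen_polyX.
- by exists (dvarX w)%:P; rewrite ?hornerC //; apply: gen_polyC; exact: gen_var.
- by exists (p1 + p2); rewrite ?hornerD //; exact: gen_polyD.
- by exists (p1 * p2); rewrite ?hornerM //; exact: gen_polyM.
Qed.

End Generated.

(** * A ranking of the indeterminates *)

Section Ranking.
Context (m n : nat).
Local Notation V := (ddvar m n).
Implicit Types (v w : V).

(** The exponents of the operators, together with the index of y_j. An operator adds a unit vector,
    so the lexicographic order on these vectors is compatible with T. *)
Definition ddcoord (i : option (option 'I_m)) v : nat :=
  if i is Some a then v.1 a else v.2.

Definition ddlt v w := lexlt ddcoord (enum {: option (option 'I_m)}) v w.

Definition below v : set V := [set w | ddlt w v].

Lemma ddcoord_ddact a i v :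
  ddcoord i (ddact a v) = ((Some a == i) + ddcoord i v)%N.
Proof. by case: i => [b|] //=; rewrite cmM cmU. Qed.

Lemma ddcoord_inj v w : (forall i, ddcoord i v = ddcoord i w) -> v = w.
Proof.
case: v w => [t j] [t' j'] h; congr pair; last exact: val_inj (h None).
by apply/eqP/cmP => a; exact: (h (Some a)).
Qed.

Lemma ddlt_total v w : [\/ ddlt v w, ddlt w v | v = w].
Proof.
have [||h] := lexlt_total ddcoord (enum {: option (option 'I_m)}) v w.
- by constructor 1.
- by constructor 2.
- by constructor 3; apply: ddcoord_inj => i; apply: h; rewrite mem_enum.
Qed.

Lemma ddlt_ddact a v : ddlt v (ddact a v).
Proof.
apply: (lexlt_incr (h := ddact a)) => [i x|]; first by rewrite ddcoord_ddact leq_addl.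
by exists (Some a); rewrite ?mem_enum // ddcoord_ddact eqxx.
Qed.

Lemma below_ddact a v : below v `<=` below (ddact a v).
Proof. by move=> w wv; exact: lexlt_trans wv (ddlt_ddact a v). Qed.

Lemma ddact_below a v : below v `<=` ddact a @^-1` below (ddact a v).
Proof.
move=> w; rewrite /below /ddlt /= (lexlt_translate _ (e := fun i => Some a == i)) //.
by move=> i x; rewrite ddcoord_ddact.
Qed.

(** Divisibility in T is comparison of exponents; this turns the outcome of Dickson's lemma into an
    element of T. *)
Lemma ddvar_le v w : (forall a, v.1 a <= w.1 a)%N -> v.2 = w.2 ->
  exists t, w = (mmul t v.1, v.2).
Proof.
case: v w => [t j] [t' j'] /= le ->; exists (divcm t' t); congr pair.
by apply/eqP/cmP => a; rewrite (cmM a (divcm t' t)) divcmE subnK.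
Qed.

End Ranking.

(** * Leaders, and the action of the operators on polynomials in a leader *)

Section LeadingVariable.
Context (m : nat) (K : ddFieldType m) (n : nat).
Local Notation V := (ddvar m n).
Local Notation R := (ddpoly m K n).
Implicit Types (A : set V) (v w : V) (f g : R) (p q : {poly R}).

Lemma gen_below_sub v w f : ddlt v w \/ v = w ->
  gen (v |` below v) f -> gen (w |` below w) f.
Proof.
case=> [vw|->//]; apply: gen_sub => u [->|uv]; right => //.
exact: lexlt_trans uv vw.
Qed.

(** The larger of the two indeterminates serves for a sum or a product. As terms may cancel, [v] is
    only an upper bound for the indeterminates of [f]. *)
Lemma gen_leader A f : gen A f ->
  (exists c, f = c%:MP) \/ exists2 v, A v & gen (v |` below v) f.
Proof.
have merge (op : R -> R -> R) f1 f2 :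
    (forall c d, exists e, op c%:MP d%:MP = e%:MP) ->
    (forall B g1 g2, gen B g1 -> gen B g2 -> gen B (op g1 g2)) ->
    (exists c, f1 = c%:MP) \/ (exists2 v, A v & gen (v |` below v) f1) ->
    (exists c, f2 = c%:MP) \/ (exists2 v, A v & gen (v |` below v) f2) ->
    (exists c, op f1 f2 = c%:MP) \/
      exists2 v, A v & gen (v |` below v) (op f1 f2).
  move=> opC opG [[c ->]|[v Av hv]] [[d ->]|[w Aw hw]].
  - by left; exact: opC.
  - by right; exists w => //; apply: opG => //; exact: gen_const.
  - by right; exists v => //; apply: opG => //; exact: gen_const.
  - right; have [vw|wv|vw] := ddlt_total v w.
    + by exists w => //; apply: opG => //; apply: gen_below_sub hv; left.
    + by exists v => //; apply: opG => //; apply: gen_below_sub hw; left.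
    + by exists w => //; apply: opG => //; apply: gen_below_sub hv; right.
elim=> [c|v Av|f1 f2 _ h1 _ h2|f1 f2 _ h1 _ h2].
- by left; exists c.
- by right; exists v => //; apply: gen_var; left.
- apply: (merge +%R) h1 h2 => [c d|]; last exact: gen_add.
  by exists (c + d); rewrite raddfD.
- apply: (merge *%R) h1 h2 => [c d|]; last exact: gen_mul.
  by exists (c * d); rewrite rmorphM.
Qed.

Lemma ddop_dvarX a v : ddop a (dvarX K v) = dvarX K (ddact a v).
Proof. by case: v => t j; exact: ddop_dvar. Qed.

Lemma ddop_sigma_horner p f :
  ddop None p.[f] = (map_poly (ddop None : R -> R) p).[ddop None f].
Proof. exact: esym (horner_map ((sigma : R -> R) : {rmorphism R -> R}) p f). Qed.

Lemma ddop_delta_horner i p f : ddop (Some i) p.[f] =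
  (map_poly (ddop (Some i) : R -> R) p).[f] + p^`().[f] * ddop (Some i) f.
Proof.
exact: (derivation_horner (D := ((delta i : R -> R) : {additive R -> R}))
  (@pdeltaM m K n i)).
Qed.

Lemma ddop0 a : ddop a (0 : R) = 0.
Proof. by apply: (addIr (ddop a (0 : R))); rewrite -ddopD !add0r. Qed.

Lemma gen_poly_map_ddop a v p :
  gen_poly (below v) p -> gen_poly (below (ddact a v)) (map_poly (ddop a : R -> R) p).
Proof.
move=> hp i; rewrite coef_map_id0; last exact: ddop0.
by apply: gen_ddop (hp i); [exact: below_ddact|exact: ddact_below].
Qed.

End LeadingVariable.

(** * The chain of the ideals sigma^-k(P) and its union *)

Section PrimeIdeals.
Context (m : nat) (R : ddRingType m).
Implicit Types (I P : set R).

Lemma is_idealB I x y : is_ideal I -> I x -> I y -> I (x - y).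
Proof. by case=> _ ID IM Ix Iy; rewrite -mulN1r; apply: ID => //; exact: IM. Qed.

Lemma prime_dd_ideal_preimage P k :
  is_prime_dd_ideal P -> is_prime_dd_ideal (iter k sigma @^-1` P).
Proof.
move=> hP; elim: k => // k IH.
(* Leaves a single preimage under [sigma] of an arbitrary prime ideal [J]. *)
have -> : iter k.+1 sigma @^-1` P = sigma @^-1` (iter k sigma @^-1` P).
  by apply/seteqP; split=> x /=; rewrite -iterS iterSr.
move: IH; move: (iter k sigma @^-1` P) => J [[[J0 JD JM] Jop] [_ J1 JP]].
have hJ : is_ideal (sigma @^-1` J).
  split=> [|x y|a x] /=; first by rewrite raddf0.
    by rewrite raddfD; exact: JD.
  by rewrite rmorphM; exact: JM.
split; [split=> // [[i|] x /= Jx]|split=> //= [|x y]].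
- by rewrite -delta_sigma; exact: (Jop (Some i)).
- exact: (Jop None).
- by rewrite rmorph1.
- by rewrite rmorphM; exact: JP.
Qed.

Lemma preimage_sub P k l : is_prime_dd_ideal P -> (k <= l)%N ->
  iter k sigma @^-1` P `<=` iter l sigma @^-1` P.
Proof.
move=> [[_ Pop] _] kl x; rewrite /preimage /= -(subnK kl) iterD.
by elim: (l - k)%N => // j IH /IH; exact: (Pop None).
Qed.

(** An increasing union of prime ideals is prime: two elements of it lie in a common member of the
    chain. *)
Lemma reflexive_closure_prime P :
  is_prime_dd_ideal P -> is_prime_ideal (reflexive_closure P).
Proof.
move=> hP; have sub := preimage_sub hP.
have prime k : is_prime_ideal (iter k sigma @^-1` P).
  by case: (prime_dd_ideal_preimage k hP).
split; first split.
- by exists 0%N; case: (prime 0%N) => [[]].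
- move=> x y [k Px] [l Py]; exists (maxn k l).
  have [[_ PD _] _ _] := prime (maxn k l).
  by apply: PD; [exact: (sub _ _ (leq_maxl k l))|exact: (sub _ _ (leq_maxr k l))].
- by move=> a x [k Px]; exists k; case: (prime k) => [[_ _ PM] _ _]; exact: PM.
- by move=> [k P1]; case: (prime k).
- move=> x y [k Pxy]; case: (prime k) => _ _ /(_ x y Pxy).
  by case=> ?; [left|right]; exists k.
Qed.

End PrimeIdeals.

(** * Cancellation of leading terms of univariate polynomials *)

Lemma size_sub_leq (A : nzRingType) (p q : {poly A}) d :
  (size p <= d.+1)%N -> (size q <= d.+1)%N -> p`_d = q`_d ->
  (size (p - q)%R <= d)%N.
Proof.
move=> sp sq epq; apply/leq_sizeP => j; rewrite coefB leq_eqVlt.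
case/orP=> [/eqP<-|lt_dj]; first by rewrite epq subrr.
by rewrite !nth_default ?subrr // (leq_trans _ lt_dj).
Qed.

(** One step of pseudo-division of [p] by [q]. *)
Lemma size_cross_sub (A : comNzRingType) (p q : {poly A}) :
  (0 < size q <= size p)%N ->
  (size ((lead_coef q)%:P * p -
         (lead_coef p)%:P * 'X^(size p - size q) * q)%R < size p)%N.
Proof.
case/andP=> q0 qp; have sp : (size p).-1.+1 = size p.
  by rewrite prednK // (leq_trans q0).
rewrite -sp ltnS sp -mulrA !mul_polyC; apply: size_sub_leq.
- by rewrite sp size_scale_leq.
- rewrite sp (leq_trans (size_scale_leq _ _)) // (leq_trans (size_polyMleq _ _)) //.
  by rewrite size_polyXn /= subnK.
- rewrite !coefZ coefXnM ifN; last first.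
    by rewrite -leqNgt; move: (size p) (size q) q0 qp {sp} => a b; lia.
  rewrite mulrC /lead_coef; congr (_ * _`_ _).
  by move: (size p) (size q) q0 qp {sp} => a b; lia.
Qed.

(** The shape of a derivative delta_i f in its new leader, with [a] the separant of f. *)
Lemma linear_polyP (A : comNzRingType) (a b x : A) (p := a%:P * 'X + b%:P) :
  a != 0 -> [/\ size p = 2, lead_coef p = a, p.[x] = a * x + b & p^`().[x] = a].
Proof.
move=> a0; have sp : size p = 2.
  by rewrite size_MXaddC polyC_eq0 (negPf a0) size_polyC a0.
split=> //; first by rewrite /lead_coef sp /= coefD coefMX !coefC /= addr0.
  by rewrite hornerMXaddC hornerC.
by rewrite derivD derivM derivX !derivC mul0r add0r addr0 mulr1 hornerC.
Qed.

(** * Minimal elements of Q outside J, and their reduction *)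

Section Reduction.
Context (m : nat) (K : ddFieldType m) (n : nat).
Local Notation V := (ddvar m n).
Local Notation R := (ddpoly m K n).
Implicit Types (v w : V) (f g : R) (p q : {poly R}).
Context (char0 : [pchar K] =i pred0).
Context (J Q : set R).
Hypotheses (hJ : is_prime_dd_ideal J) (hQ : is_prime_ideal Q).
Hypothesis JQ : J `<=` Q.
Hypothesis Qrefl : forall f, Q (ddop None f) -> Q f.

Let J0 : J 0. Proof. by case: hJ => [[[]]]. Qed.
Let JM a x : J x -> J (a * x). Proof. by case: hJ => [[[_ _]]] h _ _; exact: h. Qed.
Let JD x y : J x -> J y -> J (x + y).
Proof. by case: hJ => [[[_ h _]]] _ _; exact: h. Qed.
Let Jprime x y : J (x * y) -> J x \/ J y.
Proof. by case: hJ => _ [_ _]; apply. Qed.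
Let Jop a x : J x -> J (ddop a x). Proof. by case: hJ => [[_ h]] _; exact: h. Qed.
Let Q1 : ~ Q 1. Proof. by case: hQ. Qed.
Let QM a x : Q x -> Q (a * x). Proof. by case: hQ => [[_ _ h]] _ _; exact: h. Qed.
Let QB x y : Q x -> Q y -> Q (x - y).
Proof. by case: hQ => [h] _ _; exact: is_idealB. Qed.

(* J plays the role of P_k and Q that of P*; [p] is an element of Q \ J written
   as a polynomial in its leader [v] over the lower indeterminates. *)
Definition bad v p :=
  [/\ gen_poly (below v) p, Q p.[dvarX K v] & ~ J p.[dvarX K v]].

Definition minbad v p :=
  [/\ bad v p, forall w q, ddlt w v -> ~ bad w q
    & forall q, (size q < size p)%N -> ~ bad v q].

(** Both non-membership conditions are carried along: [sigma] preserves each of them, while a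
    derivation makes the separant the new leading coefficient. *)
Definition reducer v s := exists q,
  [/\ gen_poly (below v) q, J q.[dvarX K v], (1 < size q <= s)%N,
      ~ Q (lead_coef q) & ~ Q q^`().[dvarX K v]].

(** In characteristic zero a positive integer is a unit of K. *)
Lemma natr_cancel d f : (0 < d)%N -> J (d%:R * f) -> J f.
Proof.
move=> d0 /(JM ((d%:R)^-1)%:MP); rewrite mulrA.
have -> : ((d%:R)^-1)%:MP * d%:R = 1 :> R; last by rewrite mul1r.
have -> : d%:R = (d%:R)%:MP :> R by rewrite rmorph_nat.
rewrite -rmorphM mulVf //; move/pcharf0P: char0 => ->; rewrite -lt0n //.
Qed.

(** A nonzero constant is invertible, and [Q] is proper. *)
Lemma const_mem c : Q c%:MP -> J c%:MP.
Proof.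
have [->|c0] := eqVneq c 0; first by rewrite raddf0.
by move=> /(QM (c^-1)%:MP); rewrite -rmorphM mulVf.
Qed.

Lemma exists_minbad : ~ Q `<=` J -> exists v p, minbad v p.
Proof.
move=> nQJ.
have [v [p hp] vmin] : exists2 v, (exists p, bad v p) &
    forall w, ddlt w v -> ~ exists q, bad w q.
  (* An element of [Q] outside [J] is not constant, so it has a leader. *)
  apply: lexlt_min; apply: contrapT => nex; apply: nQJ => f Qf.
  apply: contrapT => nJf; case: (gen_leader (gen_setT f)) => [[c ec]|[v _ hv]].
    by apply: nJf; rewrite ec in Qf *; exact: const_mem.
  have [p hp ep] := gen_setU1 hv.
  by apply: nex; exists v, p; split=> //; rewrite -ep.
have [q hq qmin] : exists2 q, bad v q & forall p', bad v p' -> (size q <= size p')%N.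
  by apply: (@ex_min_measure _ (fun p' : {poly R} => size p')); exists p.
exists v, q; split=> // [w p' wv bp'|p' lt bp'].
  by apply: (vmin w wv); exists p'.
by have := qmin _ bp'; rewrite leqNgt lt.
Qed.

Section MinimalBad.
Context (v : V) (p : {poly R}).
Hypothesis hp : minbad v p.
Let x := dvarX K v.

Lemma minbad_smaller q : gen_poly (below v) q -> (size q < size p)%N ->
  Q q.[x] -> J q.[x].
Proof.
by move=> hq lt Qq; apply: contrapT => nJ; case: hp => _ _ /(_ q lt); apply.
Qed.

Lemma minbad_lower f : gen (below v) f -> Q f -> J f.
Proof.
move=> /gen_leader[[c ->]|[w wv hf]]; first exact: const_mem.
have [q hq ->] := gen_setU1 hf => Qq; apply: contrapT => nJ.
by case: hp => _ /(_ w q wv) + _; apply.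
Qed.

Lemma minbad_size : (1 < size p)%N.
Proof.
case: hp => [[gp Qp nJp] _ _]; rewrite ltnNge; apply/negP => /size1_polyC ep.
by apply: nJp; rewrite ep hornerC in Qp *; exact: minbad_lower.
Qed.

(** Otherwise the leading coefficient, which involves lower indeterminates only, is in [J]; without
    its leading term [p] gives a smaller element of [Q], also in [J], and the sum is in [J]. *)
Lemma minbad_lead : ~ Q (lead_coef p).
Proof.
case: hp => [[gp Qp nJp] _ _] Qc; apply: nJp.
have Jc : J (lead_coef p) by apply: minbad_lower => //; exact: gp.
pose d := (size p).-1; have sp : size p = d.+1.
  by rewrite prednK // ltnW ?minbad_size.
pose q := p - (lead_coef p)%:P * 'X^d.
have vq : q.[x] = p.[x] - x ^+ d * lead_coef p.
  by rewrite hornerD hornerN hornerM hornerC hornerXn mulrC.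
have -> : p.[x] = q.[x] + x ^+ d * lead_coef p by rewrite vq subrK.
apply: JD; last exact: JM.
apply: minbad_smaller.
- apply: gen_polyD => //; apply: gen_polyN; apply: gen_polyM.
    by apply: gen_polyC; exact: gp.
  exact: gen_polyXn.
- rewrite sp ltnS; apply: size_sub_leq; first by rewrite sp.
    rewrite mul_polyC; apply: leq_trans (size_scale_leq _ _) _; by rewrite size_polyXn.
  by rewrite coefCM coefXn eqxx mulr1.
- by rewrite vq; apply: QB => //; exact: QM.
Qed.

(** Otherwise the separant, having smaller degree, is in [J], and so is d times the value of [p],
    where d is the degree. *)
Lemma minbad_separant : ~ Q p^`().[x].
Proof.
case: hp => [[gp Qp nJp] _ _] QS; apply: nJp.
pose d := (size p).-1; have sp : size p = d.+1.
  by rewrite prednK // ltnW ?minbad_size.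
have d0 : (0 < d)%N by rewrite -ltnS -sp minbad_size.
have gS := gen_poly_deriv gp.
have JS : J p^`().[x].
  apply: minbad_smaller => //; apply: lt_size_deriv.
  by rewrite -size_poly_eq0 sp.
apply: (natr_cancel d0).
(* As in Euler's identity, d p and X p' have the same leading term, so [q] has smaller size than
   [p]. *)
pose q := (d%:R)%:P * p - 'X * p^`().
have vq : q.[x] = d%:R * p.[x] - x * p^`().[x].
  by rewrite hornerD hornerN !hornerM hornerC hornerX.
have -> : d%:R * p.[x] = q.[x] + x * p^`().[x] by rewrite vq subrK.
apply: JD; last exact: JM.
apply: minbad_smaller.
- apply: gen_polyD; first by apply: gen_polyM => //; apply: gen_polyC; exact: gen_nat.
  by apply: gen_polyN; apply: gen_polyM => //; exact: gen_polyX.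
- rewrite sp ltnS; apply: size_sub_leq.
  + by rewrite mul_polyC; apply: leq_trans (size_scale_leq _ _) _; rewrite sp.
  + rewrite mulrC; apply: leq_trans (size_polyMleq _ _) _; rewrite size_polyX addn2 /=.
    by rewrite ltnS -ltnS -sp; apply: lt_size_deriv; rewrite -size_poly_eq0 sp.
  + by rewrite coefCM coefXM eqn0Ngt d0 coef_deriv prednK // mulr_natl.
- by rewrite vq; apply: QB; exact: QM.
Qed.

(** The pseudo-remainder is smaller and in [Q], hence in [J]. Then [J] contains the product of
    [lead_coef q] and the value of [p], and primality puts one of them in [J], which is
    impossible. *)
Lemma minbad_irreducible : ~ reducer v (size p).
Proof.
case: hp => [[gp Qp nJp] _ _] [q [gq Jq /andP[s1 sqp] nQl _]].
pose e := (size p - size q)%N.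
pose r := (lead_coef q)%:P * p - (lead_coef p)%:P * 'X^e * q.
have vr : r.[x] = lead_coef q * p.[x] - lead_coef p * x ^+ e * q.[x].
  by rewrite hornerD hornerN !hornerM !hornerC hornerXn.
suff : J (lead_coef q * p.[x]) by case/Jprime => // /JQ.
have -> : lead_coef q * p.[x] = r.[x] + lead_coef p * x ^+ e * q.[x].
  by rewrite vr subrK.
apply: JD; last exact: JM.
apply: minbad_smaller.
- apply: gen_polyD; first by apply: gen_polyM => //; apply: gen_polyC; exact: gq.
  apply: gen_polyN; apply: gen_polyM => //; apply: gen_polyM; last exact: gen_polyXn.
  by apply: gen_polyC; exact: gp.
- by apply: size_cross_sub; rewrite (ltnW s1).
- by rewrite vr; apply: QB; apply: QM => //; exact: JQ.
Qed.

End MinimalBad.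

(** A derivation yields S * (delta_i v) + r, where S is the separant and both S and r involve only
    indeterminates below delta_i v. For [sigma], the new leading coefficient and separant are images
    of the old ones, outside [Q] by [Qrefl]. *)
Lemma reducer_ddact a v s : reducer v s -> reducer (ddact a v) s.
Proof.
case=> q [gq Jq /andP[s1 sq] nQl nQS].
have Jaq := Jop a Jq; case: a Jaq => [i|] Jaq.
  have gS : gen (below (ddact (Some i) v)) q^`().[dvarX K v].
    apply: gen_horner; last exact/gen_var/ddlt_ddact.
    by move=> j; apply: gen_sub (gen_poly_deriv gq j); exact: below_ddact.
  have S0 : q^`().[dvarX K v] != 0.
    by apply/eqP => e; apply: nQS; rewrite e; exact: JQ.
  move: Jaq; rewrite ddop_delta_horner ddop_dvarX.
  set S := q^`().[_] in gS S0 nQS *; set r := (map_poly _ _).[_] => Jaq.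
  have [sz lc vx dx] := linear_polyP r (dvarX K (ddact (Some i) v)) S0.
  exists (S%:P * 'X + r%:P); split.
  - apply: gen_polyD; last first.
      apply: gen_polyC; apply: gen_horner; last exact/gen_var/ddlt_ddact.
      exact: gen_poly_map_ddop.
    by apply: gen_polyM; [exact: gen_polyC|exact: gen_polyX].
  - by rewrite vx addrC.
  - by rewrite sz; exact: leq_trans s1 sq.
  - by rewrite lc.
  - by rewrite dx.
(* Ensures that applying [sigma] to the coefficients keeps the size. *)
have l0 : ddop None (lead_coef q) != 0.
  by apply/eqP => e; apply: nQl; apply: Qrefl; rewrite e; exact: JQ.
have sz : size (map_poly (ddop None : R -> R) q) = size q.
  exact: size_poly_eq.
exists (map_poly (ddop None : R -> R) q); split.
- exact: gen_poly_map_ddop.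
- by rewrite -ddop_dvarX -ddop_sigma_horner.
- by rewrite sz s1.
- by rewrite lead_coef_map_eq // => /Qrefl.
- move=> h; apply: nQS; apply: Qrefl.
  rewrite ddop_sigma_horner ddop_dvarX.
  suff <- : (map_poly (ddop None : R -> R) q)^`() =
    map_poly (ddop None : R -> R) q^`() by [].
  exact: (deriv_map ((sigma : R -> R) : {rmorphism R -> R}) q).
Qed.

(** Induction on the degree of [t], peeling off one operator at a time. *)
Lemma reducer_mmul t v s : reducer v s -> reducer (mmul t v.1, v.2) s.
Proof.
move=> hv; have [d] := ubnP (mdeg t); elim: d t => [|d IH] t le.
  by exfalso; rewrite ltn0 in le.
have [/eqP/mdeg_eq0I->|nt] := boolP (mdeg t == 0%N).
  by rewrite mul1m -surjective_pairing.
have [a ta] : exists a, (0 < t a)%N.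
  case: (fset_0Vmem (finsupp t)) => [e|[a at_]].
    by rewrite mdegE e big_seq_fset0 eqxx in nt.
  by exists a; rewrite lt0n cmE_neq0.
have et := divcmUK ta.
have -> : (mmul t v.1, v.2) = ddact a (mmul (divcm t (ucm a)) v.1, v.2).
  by congr pair; rewrite /= {1}et [mmul (divcm _ _) _]mulmC mulmA.
apply: reducer_ddact; apply: IH.
by move: le; rewrite ltnS {1}et mdegM mdegU addn1.
Qed.

End Reduction.

(** * Stabilisation of the chain sigma^-k(P) *)

Theorem corollary4p4 (m n : nat) (K : ddFieldType m)
    (char0 : [pchar K] =i pred0) (P : set (ddpoly m K n)) :
  is_prime_dd_ideal P ->
  exists k : nat, reflexive_closure P = iter k sigma @^-1` P.
Proof.
move=> hP; set Q := reflexive_closure P; pose J k := iter k sigma @^-1` P.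
have hQ : is_prime_ideal Q := reflexive_closure_prime hP.
have hJ k : is_prime_dd_ideal (J k) := prime_dd_ideal_preimage k hP.
have JQ k : J k `<=` Q by move=> f Jf; exists k.
have Qrefl f : Q (ddop None f) -> Q f.
  by case=> k Pf; exists k.+1; rewrite iterSr.
suff [k QJ] : exists k, Q `<=` J k by exists k; apply/seteqP; split=> //; exact: JQ.
apply: contrapT => nex.
have /boolp.choice[vp hvp] k : exists x : ddvar m n * {poly ddpoly m K n},
    minbad (J k) Q x.1 x.2.
  have [|v [p hp]] := exists_minbad (hJ k) hQ; last by exists (v, p).
  by move=> QJ; apply: nex; exists k.
pose v k := (vp k).1; pose p k := (vp k).2.
(* Monotonicity of both (v k).2 and n - (v k).2 makes (v k).2 constant. *)
pose u (i : option (option 'I_m) + bool) k := match i with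
  | inl c => ddcoord c (v k)
  | inr true => size (p k)
  | inr false => (n - (v k).2)%N
  end.
have [g [gmono umono]] :=
  nondecreasing_subseq_family (enum {: option (option 'I_m) + bool}) u.
have {}umono i a b : (a <= b)%N -> (u i (g a) <= u i (g b))%N.
  by apply: umono; rewrite mem_enum.
have gge k : (k <= g k)%N.
  by elim: k => // k IH; rewrite (leq_ltn_trans IH) // gmono.
(* Membership in the union [Q] supplies an [l] with the element of index [g 0] in [J l]; as l <= g
   l, it is also in [J (g l)]. *)
have [[gp [l Pl] _] _ _] := hvp (g 0%N).
have Jl : J (g l) (p (g 0%N)).[dvarX K (v (g 0%N))].
  exact: (preimage_sub hP (gge l)).
(* The element of index [g 0] is minimal relative to [J (g 0)], but its leading coefficient and
   separant avoid [Q], which does not depend on the index, so it can reduce modulo [J (g l)]. *)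
have red0 : reducer (J (g l)) Q (v (g 0%N)) (size (p (g l))).
  exists (p (g 0%N)); split=> //.
  - rewrite (minbad_size (hJ _) hQ (hvp _)) //.
    exact: (umono (inr true) 0%N l).
  - exact: (minbad_lead (hJ _) hQ (hvp _)).
  - exact: (minbad_separant char0 (hJ _) hQ (hvp _)).
have [a||t vt] := @ddvar_le m n (v (g 0%N)) (v (g l)).
- exact: (umono (inl (Some a))).
- have := umono (inl None) 0%N l (leq0n l).
  have := umono (inr false) 0%N l (leq0n l).
  by rewrite /u /=; have := ltn_ord (v (g 0%N)).2; have := ltn_ord (v (g l)).2;
    move=> *; apply: val_inj => /=; lia.
- apply: (minbad_irreducible (hJ _) hQ (JQ _) (hvp (g l))).
  rewrite -/(v (g l)) vt; exact: (reducer_mmul (hJ _) (JQ _) Qrefl t red0).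
Qed.
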